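(* Let $G$ be a $K_4$-minor-free graph and let $x,y$ be distinct vertices of $G$. Then $G$ is $(2,2)$-AT extendable with respect to $(x,y)$. Moreover, if $\{x,y\}$ is not connected by a chain of diamonds, then $G$ is $(2,1)$-AT extendable with respect to $(x,y)$.
   Context: All graphs are finite and simple. For an orientation $D$ of a graph $G$, an Eulerian sub-digraph of $D$ is a spanning sub-digraph $F$ of $D$ with $d^+_F(v)=d^-_F(v)$ for every vertex $v$. Let $\mathrm{diff}(D)$ be the number of Eulerian sub-digraphs of $D$ with an even number of arcs minus the number with an odd number of arcs; $D$ is an AT-orientation if $\mathrm{diff}(D)\neq 0$. For $f:V(G)\to\mathbb{N}$, $G$ is $f$-AT if $G$ has an AT-orientation $D$ with $d^+_D(v)\le f(v)-1$ for every vertex $v$. $G$ is $f$-choosable if for every assignment of lists $L(v)\subseteq\mathbb{N}$ with $|L(v)|\ge f(v)$ there is a proper coloring $\varphi$ with $\varphi(v)\in L(v)$ for all $v$. Given distinct vertices $v_1,\dots,v_k$ and integers $a_i\in\{1,2\}$, define $f(v_i)=a_i$ for $i\in[k]$ and $f(v)=3$ for all other vertices; $G$ is $(a_1,\dots,a_k)$-AT extendable (resp. $(a_1,\dots,a_k)$-list extendable) with respect to $(v_1,\dots,v_k)$ if $G$ is $f$-AT (resp. $f$-choosable). For $n\in\mathbb{N}$, the chain of diamonds $D_n$ is the graph with vertex set $\{u_i,v_i,w_i:i\in[n]\}\cup\{u_0\}$ and edge set $\{u_{i-1}v_i,u_{i-1}w_i,v_iw_i,v_iu_i,w_iu_i: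 i\in[n]\}$; let $U(D_n)=\{u_0,\dots,u_n\}$. A set $X$ of distinct vertices of $G$ is connected by a chain of diamonds if there exist $n\in\mathbb{N}$ and a graph homomorphism $\varphi:D_n\to G$ with $X\subseteq\varphi(U(D_n))$. *)

(* Defs.v *)
From mathcomp Require Import all_boot all_order all_algebra.
Set Implicit Arguments. Unset Strict Implicit. Unset Printing Implicit Defensive.
Import GRing.Theory Num.Theory.

Definition simple_graph (T : finType) (e : rel T) : Prop :=
  symmetric e /\ irreflexive e.

Definition induced_connected (T : finType) (e : rel T) (B : {set T}) : Prop :=
  forall a b, a \in B -> b \in B ->
    connect (fun u v => [&& e u v, u \in B & v \in B]) a b.

Definition has_K4_minor (T : finType) (e : rel T) : Prop :=
  exists B : 'I_4 -> {set T},
    (forall i, B i != set0) /\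
    (forall i, induced_connected e (B i)) /\
    (forall i j, i != j -> [disjoint B i & B j]) /\
    (forall i j, i != j -> exists a b, [/\ a \in B i, b \in B j & e a b]).

Definition K4_minor_free (T : finType) (e : rel T) : Prop := ~ has_K4_minor e.

Definition orientation (T : finType) (e : rel T) (o : rel T) : Prop :=
  (forall a b, o a b -> e a b) /\ (forall a b, e a b -> o a b (+) o b a).

Definition arcs (T : finType) (o : rel T) : {set T * T} :=
  [set p | o p.1 p.2].

Definition outdeg (T : finType) (F : {set T * T}) (v : T) : nat :=
  #|[set p in F | p.1 == v]|.
Definition indeg (T : finType) (F : {set T * T}) (v : T) : nat :=
  #|[set p in F | p.2 == v]|.

Definition eulerian_sub (T : finType) (o : rel T) (F : {set T * T}) : bool :=
  (F \subset arcs o) && [forall v, outdeg F v == indeg F v].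

Definition diffD (T : finType) (o : rel T) : int :=
  (\sum_(F : {set T * T} | eulerian_sub o F) (-1) ^+ #|F|)%R.

Definition AT_orientation (T : finType) (o : rel T) : Prop := diffD o != 0%R.

Definition f_AT (T : finType) (e : rel T) (f : T -> nat) : Prop :=
  exists o : rel T, [/\ orientation e o, AT_orientation o &
    forall v, outdeg (arcs o) v + 1 <= f v].

Definition ext_fun (T : finType) (x y : T) (a b : nat) : T -> nat :=
  fun v => if v == x then a else if v == y then b else 3.

Definition AT_extendable2 (T : finType) (e : rel T) (a b : nat) (x y : T) : Prop :=
  f_AT e (ext_fun x y a b).

(* A set X is connected by a chain of diamonds: a graph homomorphism
   phi : D_n -> G, written as the images u i (0<=i<=n), v i, w i (1<=i<=n),
   with X contained in {u 0, ..., u n}. *)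
Definition diamond_chain_hom (T : finType) (e : rel T) (n : nat)
    (u v w : nat -> T) : Prop :=
  forall i, 1 <= i <= n ->
    [/\ e (u i.-1) (v i), e (u i.-1) (w i), e (v i) (w i),
        e (v i) (u i) & e (w i) (u i)].

Definition connected_by_chain_of_diamonds (T : finType) (e : rel T)
    (X : {set T}) : Prop :=
  exists n (u v w : nat -> T), diamond_chain_hom e n u v w /\
    (forall z, z \in X -> exists2 i, i <= n & u i = z).

(* Main.v *)
(** The proof is by induction on the number of edges, with [f y = k] in {1, 2}.  A
    vertex of degree less than [f v] may be made a source and deleted.  In a
    K4-minor-free graph some vertex other than [y] has degree at most 2, and this
    persists when a vertex of degree 2 is suppressed (deleted, its neighbours being
    joined), which leaves one configuration: [x] has exactly two neighbours [a], [b],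
    they are adjacent, and [a] has exactly one further neighbour [z].  Orienting
    a->x, a->b, x->b, z->a then reduces the problem to the graph without [x] and [a],
    with [z] in the role of [x].

    For [k = 1] this fails only if [z] and [y] are joined by a chain of diamonds there.
    If [b] is adjacent to [z], then [x, a, b, z] is a diamond and the chain extends to
    [x].  Otherwise [b] has degree 3 as well, with a third neighbour z' <> z, and if it
    fails for z' too, suppressing [x], [a], [b] adds the edge z z'.  The resulting graph
    is K4-minor-free, hence 3-colourable, but a 3-colouring is constant along chains of
    diamonds, so [z], [y] and z' would share a colour. *)
Require Import Defs.
From mathcomp Require Import all_boot all_order all_algebra.
From mathcomp Require Import zify.
Set Implicit Arguments. Unset Strict Implicit. Unset Printing Implicit Defensive.

(** * Deletion, suppression and K4 minors *)

Definition nbh (T : finType) (e : rel T) (v : T) : {set T} := [set w | e v w].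

(** The vertex type is kept and [v] survives as an isolated vertex, which is why low vertices are
    required below to have positive degree. *)
Definition del (T : finType) (e : rel T) (v : T) : rel T :=
  fun u w => [&& e u w, u != v & w != v].

Definition suppress (T : finType) (e : rel T) (v a b : T) : rel T :=
  fun u w => [|| del e v u w, (u == a) && (w == b) | (u == b) && (w == a)].

Lemma simple_del (T : finType) (e : rel T) (v : T) :
  simple_graph e -> simple_graph (del e v).
Proof.
case=> es ei; split=> [u w|u]; rewrite /del ?ei // es.
by case: (w == v); case: (u == v); rewrite ?andbF.
Qed.

Lemma simple_suppress (T : finType) (e : rel T) (v a b : T) :
  simple_graph e -> a != b -> simple_graph (suppress e v a b).
Proof.
move=> /(simple_del v)[ds di] nab; split=> [u w|u]; rewrite /suppress.
  by rewrite ds orbC -orbA orbC (andbC (w == a)) (andbC (w == b)) orbAC -orbA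
       [X in _ || X]orbC; case: (del e v w u); rewrite ?orbT // orbC.
rewrite di /=; apply/negP; case/orP=> /andP[/eqP-> /eqP h];
  by move: nab; rewrite h eqxx.
Qed.

Lemma K4_minor_free_sub (T : finType) (e e' : rel T) :
  subrel e' e -> K4_minor_free e -> K4_minor_free e'.
Proof.
move=> sub free [B [B0 [Bc [Bd Be]]]]; apply: free; exists B; split=> //.
split; last first.
  split=> // i j /Be[a [b [ha hb /sub hab]]]; by exists a, b.
move=> i a b ha hb; apply: (connect_sub _ (Bc i a b ha hb)) => u w /and3P[h hu hw].
by apply: connect1; rewrite hu hw (sub _ _ h).
Qed.

Lemma K4_minor_free_del (T : finType) (e : rel T) (v : T) :
  K4_minor_free e -> K4_minor_free (del e v).
Proof. by apply: K4_minor_free_sub => u w /and3P[]. Qed.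

(** A K4 minor of the suppressed graph lifts to [e] once [v] is added to the branch set that
    contains [a], if there is one: the path through [v] replaces the new edge. *)
Lemma K4_minor_free_suppress (T : finType) (e : rel T) (v a b : T) :
  simple_graph e -> e v a -> e v b -> a != b ->
  K4_minor_free e -> K4_minor_free (suppress e v a b).
Proof.
move=> [es ei] eva evb nab free [B [B0 [Bc [Bd Be]]]]; apply: free.
have nva : a != v by apply: contraTneq eva => ->; rewrite ei.
have nvb : b != v by apply: contraTneq evb => ->; rewrite ei.
have iso u : suppress e v a b v u = false.
  by rewrite /suppress /del eqxx !andbF (eq_sym v a) (eq_sym v b)
       (negPf nva) (negPf nvb).
(* After suppression [v] is isolated, so its branch set would be a singleton with no edge to the
   others. *)
have vB i : v \notin B i.
  apply/negP=> hv.
  have Bv u : u \in B i -> u = v.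
    move=> hu; have /connectP[[|w p] /= hp ->] := Bc i v u hv hu; first by [].
    by move: hp; rewrite iso.
  have [j nij] : exists j : 'I_4, i != j.
    by case: (altP (i =P ord0)) => [->|?]; [exists ord_max | exists ord0].
  have [c [d [hc _]]] := Be i j nij.
  by rewrite (Bv c hc) iso.
pose B' i := if a \in B i then v |: B i else B i.
have sB i : B i \subset B' i by rewrite /B'; case: ifP => // _; exact: subsetUr.
have vB' i : a \in B i -> v \in B' i by rewrite /B' => ->; exact: setU11.
have con i u w : u \in B i -> w \in B i ->
    connect (fun u w => [&& e u w, u \in B' i & w \in B' i]) u w.
  move=> hu hw; apply: (connect_sub _ (Bc i u w hu hw)) => {u w hu hw} u w.
  case/and3P=> h hu hw; have hu' := subsetP (sB i) _ hu.
  have hw' := subsetP (sB i) _ hw.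
  case/or3P: h => [/and3P[h _ _]|/andP[/eqP ? /eqP ?]|/andP[/eqP ? /eqP ?]]; subst.
  - by apply: connect1; rewrite h hu' hw'.
  - apply: (connect_trans (y := v)); apply: connect1.
      by rewrite es eva hu' vB'.
    by rewrite evb hw' vB'.
  - apply: (connect_trans (y := v)); apply: connect1.
      by rewrite es evb hu' vB'.
    by rewrite eva hw' vB'.
exists B'; split; last split; last split.
- by move=> i; have /set0Pn[c hc] := B0 i; apply/set0Pn; exists c; exact: (subsetP (sB i)).
- move=> i.
  have rs : symmetric (fun u w => [&& e u w, u \in B' i & w \in B' i]).
    by move=> u w /=; rewrite es; case: (u \in _); case: (w \in _).
  have key u : u \in B' i -> exists2 c, c \in B i &
      connect (fun u w => [&& e u w, u \in B' i & w \in B' i]) c u.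
    move=> hu; move: (hu); rewrite {1}/B'; case: ifP => [ha|_ hu']; last first.
      by exists u => //; exact: connect0.
    case/setU1P=> [->|hu']; last by exists u => //; exact: connect0.
    exists a => //; apply: connect1.
    by rewrite es eva vB' // (subsetP (sB i)).
  move=> u w /key[c hc hcu] /key[d hd hdw].
  apply: connect_trans hdw; apply: connect_trans (con i c d hc hd).
  by rewrite (sym_connect_sym rs).
- move=> i j nij; rewrite -setI_eq0; apply/eqP/setP=> u; rewrite !inE.
  have dij : [disjoint B i & B j] by exact: Bd.
  have dF w : w \in B i -> w \in B j -> False.
    by move=> h1 h2; have := disjointFr dij h1; rewrite h2.
  apply/negP=> /andP[]; rewrite /B'.
  case: ifP => ai; case: ifP => aj; rewrite ?in_setU1.
  + by case: (dF a).
  + by case/orP=> [/eqP->|/dF//]; rewrite (negPf (vB j)).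
  + by move=> h /orP[/eqP h'|/(dF _ h)//]; move: h; rewrite h' (negPf (vB i)).
  + exact: dF.
- move=> i j nij; have [c [d [hc hd]]] := Be i j nij.
  case/or3P=> [/and3P[h _ _]|/andP[/eqP ? /eqP ?]|/andP[/eqP ? /eqP ?]]; subst.
  + by exists c, d; split=> //; apply: (subsetP (sB _)).
  + by exists v, b; split=> //; [exact: vB' | apply: (subsetP (sB _))].
  + by exists b, v; split; [apply: (subsetP (sB _)) | exact: vB' | rewrite es].
Qed.

Lemma induced_connected_path (T : finType) (e : rel T) (x : T) (s : seq T) :
  symmetric e -> path e x s -> induced_connected e [set z in x :: s].
Proof.
move=> es p a b; set B := [set z in x :: s] => ha hb.
set r := (fun u v => [&& e u v, u \in B & v \in B]).
have rs : symmetric r.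
  by move=> u w /=; rewrite /r es; case: (u \in _); case: (w \in _).
have pr : path r x s.
  have sr : {in B &, subrel e r}.
    by move=> u w hu hw h; rewrite /r h /=; apply/andP.
  by apply: (sub_in_path sr) => //; apply/allP=> u hu; change (u \in B); rewrite inE.
rewrite in_set in ha; rewrite in_set in hb.
apply: (connect_trans (y := x)); last exact: (path_connect pr hb).
by rewrite (sym_connect_sym rs); exact: (path_connect pr ha).
Qed.

(** The branch sets are [x :: s], [c], [d] and [t]: the path joins consecutive ones and the three
    chords join the remaining pairs. *)
Lemma K4_minor_of_path (T : finType) (e : rel T) (x c d : T) (s t : seq T) :
  symmetric e -> path e x (s ++ c :: d :: t) -> uniq (x :: s ++ c :: d :: t) ->
  e x d -> has (e x) t -> has (e c) t -> has_K4_minor e.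
Proof.
move=> es p u exd /hasP[p1 p1t exp1] /hasP[p2 p2t ecp2].
case: t => [|h t] // in p u p1t p2t *.
pose L i := nth [::] [:: x :: s; [:: c]; [:: d]; h :: t] i.
move: p; rewrite cat_path /= => /and5P[ps sc cd dh pt].
have ul i j k : i < j < 4 -> k \in L i -> k \in L j -> False.
  have /and3P[_ D0 /and3P[]] : [&& uniq (x :: s),
      ~~ has (in_mem^~ (mem (x :: s))) (c :: d :: h :: t) & uniq (c :: d :: h :: t)].
    by rewrite -cat_uniq.
  rewrite in_cons negb_or => /andP[ncd nct] nd _.
  move/hasPn in D0.
  have nc : c \notin x :: s by apply: D0; rewrite mem_head.
  have nds : d \notin x :: s by apply: D0; rewrite in_cons mem_head orbT.
  have nts w : w \in h :: t -> w \notin x :: s.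
    by move=> hw; apply: D0; rewrite in_cons in_cons hw !orbT.
  rewrite /L => /andP[]; case: i => [|[|[|i]]]; case: j => [|[|[|[|j]]]] //= _ _;
    rewrite ?mem_seq1.
  - by move=> hk /eqP hk'; rewrite -hk' hk in nc.
  - by move=> hk /eqP hk'; rewrite -hk' hk in nds.
  - by move=> hk /nts; rewrite hk.
  - by move=> /eqP-> /eqP h'; rewrite h' eqxx in ncd.
  - by move=> /eqP->; rewrite (negPf nct).
  - by move=> /eqP->; rewrite (negPf nd).
have adj i j : i < j < 4 -> exists a b, [/\ a \in L i, b \in L j & e a b].
  move=> /andP[]; case: i => [|[|[|i]]]; case: j => [|[|[|[|j]]]] //= _ _.
  - by exists (last x s), c; split; rewrite /L /= ?mem_last ?mem_head.
  - by exists x, d; split; rewrite /L /= ?mem_head.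
  - by exists x, p1; split; rewrite /L /= ?mem_head.
  - by exists c, d; split; rewrite /L /= ?mem_head.
  - by exists c, p2; split; rewrite /L /= ?mem_head.
  - by exists d, h; split; rewrite /L /= ?mem_head.
exists (fun i : 'I_4 => [set z in L i]); split; last split; last split.
- move=> [[|[|[|[|i]]]] hi] //; apply/set0Pn.
  + by exists x; rewrite inE mem_head.
  + by exists c; rewrite inE mem_head.
  + by exists d; rewrite inE mem_head.
  + by exists h; rewrite inE mem_head.
- by move=> [[|[|[|[|i]]]] hi] //; exact: induced_connected_path.
- move=> i j nij; rewrite -setI_eq0; apply/eqP/setP=> k; rewrite !inE.
  apply/negP=> /andP[ki kj].
  case: (ltngtP i j) => [h'|h'|/val_inj h'].
  + by apply: (ul i j k); rewrite ?h' ?ltn_ord.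
  + by apply: (ul j i k); rewrite ?h' ?ltn_ord.
  + by rewrite h' eqxx in nij.
- move=> i j nij; case: (ltngtP i j) => [h'|h'|/val_inj h'].
  + have [|a [b [ha hb hab]]] := adj i j; first by rewrite h' ltn_ord.
    by exists a, b; rewrite !in_set.
  + have [|a [b [ha hb hab]]] := adj j i; first by rewrite h' ltn_ord.
    by exists b, a; rewrite !in_set es.
  + by rewrite h' eqxx in nij.
Qed.

(** * Vertices of degree at most two *)

Lemma nbh_avoid (T : finType) (e : rel T) (v p q : T) :
  2 < #|nbh e v| -> exists w, [/\ e v w, w != p & w != q].
Proof.
move=> h; have : 0 < #|nbh e v :\ p :\ q|.
  have := cardsD1 p (nbh e v); have := cardsD1 q (nbh e v :\ p); lia.
rewrite card_gt0 => /set0Pn[w]; rewrite !inE => /and3P[? ? ?].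
by exists w.
Qed.

Lemma cat_eq_suffix (T : Type) (s1 s2 q1 q2 : seq T) :
  s1 ++ q1 = s2 ++ q2 -> size q1 <= size q2 -> exists t, q2 = t ++ q1.
Proof.
move=> h sz; exists (drop (size s2) s1).
have hs : size s1 + size q1 = size s2 + size q2 by rewrite -!size_cat h.
have := congr1 (drop (size s2)) h; rewrite [in RHS]drop_size_cat // drop_cat => <-.
case: ltnP => // h'; have -> : size s2 - size s1 = 0 by lia.
by rewrite drop0 drop_oversize.
Qed.

(* A longest path is taken that ends in Q; then the second neighbour of its head
   x is brought as close to x as possible.  If that neighbour is d and c precedes
   it, reversing the segment from x to c gives another such path, with head c. *)
Lemma no_path_of_high_degree (T : finType) (e : rel T) (Q : seq T) :
  simple_graph e -> K4_minor_free e -> 0 < size Q <= 2 ->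
  (forall v, v \notin Q -> 0 < #|nbh e v| -> 2 < #|nbh e v|) ->
  forall x s, uniq (x :: s ++ Q) -> path e x (s ++ Q) -> False.
Proof.
move=> [es ei] free /andP[Q0 Q2] high.
(* A lexicographic measure: first the room left for a longer path, then the position of the second
   neighbour of the head, [behead] skipping the first. On a path without repetition the factor
   [#|T|.+1] exceeds every such position. *)
pose mu x p := (#|T| - size p) * #|T|.+1 + find (e x) (behead p).
have szT x (p : seq T) : uniq (x :: p) -> size p < #|T|.
  by move/card_uniqP=> /= h; rewrite -[_ < _]/(_.+1 <= _) -h max_card.
have fT x y (p : seq T) : uniq (y :: p) -> find (e x) (behead p) <= #|T|.
  move=> u; have := szT _ _ u; have := find_size (e x) (behead p).
  rewrite size_behead; lia.
suff main n x s : mu x (s ++ Q) < n -> uniq (x :: s ++ Q) -> path e x (s ++ Q) -> False.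
  by move=> x s; apply: (main (mu x (s ++ Q)).+1).
elim: n x s => [|n IH] x s; first by [].
move=> lt u p.
(* A neighbour of the head off the path would give a longer path. Every path of the same length is
   covered, since the reversed path needs this too. *)
have ext x' s' w : size s' = size s -> uniq (x' :: s' ++ Q) -> path e x' (s' ++ Q) ->
    w \notin x' :: s' ++ Q -> e x' w -> False.
  move=> sz u' p' nw ew.
  have u2 : uniq (w :: x' :: s' ++ Q) by rewrite cons_uniq nw.
  apply: (IH w (x' :: s')) => //=; last by rewrite es ew.
  have := fT w w _ u2; have := szT _ _ u2; move: lt.
  rewrite /mu /= !size_cat sz => h1 h2 h3.
  move: #|T| (size s + size Q) (find _ _) (find _ _) h1 h2 h3 => k m f1 f2 h1 h2 h3.
  have h4 : k - m = (k - m.+1).+1 by lia.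
  rewrite h4 mulSn in h1; lia.
have inQ y z : e y z -> y \notin Q -> 2 < #|nbh e y|.
  move=> h nQ; apply: high => //; rewrite card_gt0; apply/set0Pn.
  by exists z; rewrite inE.
case: (posnP (size (s ++ Q))) => [|sz0]; first by rewrite size_cat; lia.
case E : (s ++ Q) (sz0) => [|x1 r] // _.
have degx : 2 < #|nbh e x|.
  apply: (inQ x x1); first by move: p; rewrite E => /andP[].
  by move: u; rewrite cons_uniq mem_cat negb_or => /andP[/andP[]].
have in_path w : e x w -> w != x1 -> w \in r.
  move=> ew nw; have : w \in x :: s ++ Q.
    by apply/negPn/negP=> h; exact: (ext x s w).
  rewrite E !in_cons (negPf nw) /=; case: eqP => // h.
  by move: ew; rewrite h ei.
have [r1 [d [t [Er exd nr1]]]] :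
    exists r1 d t, [/\ r = r1 ++ d :: t, e x d & ~~ has (e x) r1].
  have [w [ew w1 _]] := nbh_avoid x1 x1 degx.
  have /split_find : has (e x) r by apply/hasP; exists w; first exact: in_path.
  case=> d r1 t h1 h2; exists r1, d, t; by rewrite cat_rcons.
have ext_t : has (e x) t.
  have [w [ew w1 wd]] := nbh_avoid x1 d degx.
  have := in_path w ew w1; rewrite Er mem_cat in_cons (negPf wd) /=.
  case/orP=> h; last by apply/hasP; exists w.
  by move/hasPn: nr1 => /(_ w h); rewrite ew.
set c := last x1 r1; set s0 := belast x1 r1.
have Es : s ++ Q = s0 ++ c :: d :: t.
  by rewrite E Er -cat_cons lastI cat_rcons.
(* As [d :: t] has at least two entries and [Q] at most two, [Q] lies inside it, and reversing the
   part before [d] leaves the end of the path intact. *)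
have [t' Et] : exists t', d :: t = t' ++ Q.
  apply: (cat_eq_suffix (s1 := s) (s2 := s0 ++ [:: c])); first by rewrite -catA.
  by case: (t) ext_t => //= *; lia.
(* The head [x] already has chords to [d] and into [t]; one from [c] into [t] would complete a K4
   minor. *)
have nect : ~~ has (e c) t.
  apply/negP=> h; apply: free; apply: (@K4_minor_of_path T e x c d s0 t) => //;
    by rewrite -Es.
have sz : size (rcons (rev s0) x ++ t') = size s.
  have := congr1 size Es; have := congr1 size Et.
  rewrite !size_cat size_rcons size_rev /=; clear; lia.
have ur : uniq (c :: (rcons (rev s0) x ++ t') ++ Q).
  rewrite -catA -Et -cat_cons.
  have -> : c :: rcons (rev s0) x = rev (x :: rcons s0 c).
    by rewrite rev_cons rev_rcons.
  rewrite cat_uniq rev_uniq (eq_has (a2 := mem (x :: rcons s0 c))); last first.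
    by move=> k; rewrite /= mem_rev.
  by rewrite -cat_uniq cat_cons cat_rcons -Es.
have pr : path e c ((rcons (rev s0) x ++ t') ++ Q).
  move: p; rewrite -catA -Et Es -cat_rcons !cat_path !last_rcons => /andP[p1 p2].
  rewrite -(rev_cons x s0) -(belast_rcons x s0 c) -[X in path _ X](last_rcons x s0 c).
  rewrite rev_path (eq_path (e' := e)); last by move=> ? ?; rewrite es.
  rewrite p1 /=; move: p2 => /=; case/andP=> _ ->; by rewrite exd.
have cQ : c \notin Q.
  by move: ur; rewrite cons_uniq mem_cat negb_or => /andP[/andP[]].
have ecd : e c d.
  by move: p; rewrite Es cat_path /= => /and4P[].
have degc : 2 < #|nbh e c| by exact: (inQ c d).
have [w [ew wd wl]] := nbh_avoid d (last x s0) degc.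
case: (boolP (w \in c :: (rcons (rev s0) x ++ t') ++ Q)) => hw; last first.
  exact: (ext c (rcons (rev s0) x ++ t') w).
have {hw} : w \in x :: s0.
  move: hw; rewrite -catA -Et in_cons mem_cat mem_rcons in_cons mem_rev in_cons (negPf wd).
  case/or3P=> [/eqP h|//|/= h].
    by move: ew; rewrite h ei.
  by move/hasPn: nect => /(_ w h); rewrite ew.
case: (lastP s0) Es sz ur pr wl => [|s1 l] Es sz ur pr.
  by rewrite /= mem_seq1 => /negPf->.
rewrite last_rcons in_cons mem_rcons in_cons => /negPf-> /=.
have r1E : size r1 = (size s1).+1.
  have := congr1 size Es; rewrite E Er /= !size_cat size_rcons /=; clear; lia.
(* Here [s0] is nonempty, so [c] belongs to [r1], which contains no neighbour of [x]. *)
have ncx : ~~ e c x.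
  case: (r1) r1E nr1 @c {Es sz ur pr ecd nect ew cQ degc} => // y r2 _ nr1 c.
  by apply: contraNN nr1 => h; apply/hasP; exists c; [rewrite /c /= mem_last | rewrite es].
case/orP=> [/eqP h|ws1]; first by rewrite -h ew in ncx.
(* The reversed path begins with [c], [l], [rev s1], and [w] lies in [s1]. The second neighbour of
   the head is thus at a position below [size s1], where it used to be at [size r1], that is
   [(size s1).+1]. *)
apply: (IH c (rcons (rev (rcons s1 l)) x ++ t')) => //.
have sz2 : size ((rcons (rev (rcons s1 l)) x ++ t') ++ Q) = size (s ++ Q).
  by rewrite size_cat sz size_cat.
move: lt; rewrite /mu sz2 E Er /= rev_rcons /= -!cats1 -!catA !find_cat.
have -> : has (e c) (rev s1) by apply/hasP; exists w; rewrite ?mem_rev.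
rewrite (negPf nr1) /= exd addn0 r1E.
have : has (e c) (rev s1) by apply/hasP; exists w; rewrite ?mem_rev.
rewrite has_find size_rev; clear; lia.
Qed.

Lemma nbh0 (T : finType) (e : rel T) (v : T) : nbh e v = set0 -> forall w, e v w = false.
Proof. by move=> h w; have := in_set0 w; rewrite -h inE. Qed.

(** Otherwise an edge ending at [y] would be a path excluded by [no_path_of_high_degree]; if [y] is
    isolated, the edge [u w] is one, with [w] as its end. *)
Lemma exists_low_vertex (T : finType) (e : rel T) (y u w : T) :
  simple_graph e -> K4_minor_free e -> e u w ->
  exists v, v != y /\ 0 < #|nbh e v| <= 2.
Proof.
move=> se free euw; have [es ei] := se.
case: (pickP [pred v | (v != y) && (0 < #|nbh e v| <= 2)]) => [v /andP[]|none].
  by exists v.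
have high v : v != y -> 0 < #|nbh e v| -> 2 < #|nbh e v|.
  by move=> vy v0; have := none v; rewrite /= vy v0 /= leqNgt => /negbFE.
have [/eqP/nbh0 hy|/set0Pn[z]] := boolP (nbh e y == set0); last rewrite inE => eyz.
  case: (@no_path_of_high_degree T e [:: w] se free isT _ u [::]) => //=.
  - move=> v _ v0; apply: high => //; apply: contraTneq v0 => ->.
    by rewrite card_gt0 negbK; apply/eqP/setP=> k; rewrite !inE hy.
  - by rewrite mem_seq1 andbT; apply: contraTneq euw => ->; rewrite ei.
  - by rewrite euw.
case: (@no_path_of_high_degree T e [:: y] se free isT _ z [::]) => //=.
- by move=> v; rewrite mem_seq1; exact: high.
- by rewrite mem_seq1 andbT; apply: contraTneq eyz => ->; rewrite ei.
- by rewrite es eyz.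
Qed.

Lemma nbh_del (T : finType) (e : rel T) (v u : T) :
  nbh (del e v) u = if u == v then set0 else nbh e u :\ v.
Proof.
apply/setP=> w; case: ifP => h; rewrite !inE /del h /= ?andbF //.
by rewrite andbC.
Qed.

(** Otherwise the excluded paths with [Q] of size two show that no edge leaves the pair. Deleting
    [x] then isolates [y] and changes no degree outside the pair, so [exists_low_vertex] applies. *)
Lemma exists_low_vertex_edge (T : finType) (e : rel T) (x y u w : T) :
  simple_graph e -> K4_minor_free e -> e x y -> e u w -> w \notin [set x; y] ->
  exists v, v \notin [set x; y] /\ 0 < #|nbh e v| <= 2.
Proof.
move=> se free; have [es ei] := se.
case: (pickP [pred v | (v \notin [set x; y]) && (0 < #|nbh e v| <= 2)]) => [v /andP[]|none].
  by exists v.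
have high v : v \notin [set x; y] -> 0 < #|nbh e v| -> 2 < #|nbh e v|.
  by move=> vy v0; have := none v; rewrite /= vy v0 /= leqNgt => /negbFE.
have no_ext a b c : [set a; b] = [set x; y] -> e a b -> e b c -> c \notin [set x; y] -> False.
  move=> hab eab ebc cab; apply: (@no_path_of_high_degree T e [:: b; a] se free isT _ c [::]).
  - move=> v; rewrite !inE orbC => hv; apply: high; by rewrite -hab !inE.
  - move: cab; rewrite -hab !inE /= !inE orbC => -> /=; rewrite andbT.
    by apply: contraTneq eab => ->; rewrite ei.
  - by rewrite /= es ebc es eab.
move=> exy euw nw.
have iso a b c : [set a; b] = [set x; y] -> e a b -> e a c -> c = b.
  move=> hab eab eac; case: (boolP (c \in [set x; y])) => hc.
    move: hc; rewrite -hab !inE => /orP[/eqP h|/eqP//]; by rewrite h ei in eac.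
  by case: (no_ext b a c) => //; [rewrite setUC | rewrite es].
have nu : u \notin [set x; y].
  apply/negP; rewrite !inE => /orP[] /eqP h; subst; move: nw.
    by rewrite (iso x y w) // !inE eqxx orbT.
  have -> : w = x by apply: (iso y) => //; [rewrite setUC | rewrite es].
  by rewrite !inE eqxx.
have [|v [vy]] := @exists_low_vertex T (del e x) y u w (simple_del x se)
   (K4_minor_free_del free).
  by rewrite /del euw; move: nw nu; rewrite !inE !negb_or => /andP[-> _] /andP[-> _].
rewrite nbh_del; case: (eqVneq v x) => [_|vx]; first by rewrite cards0.
have nv : v \notin [set x; y] by rewrite !inE negb_or vx.
have -> : nbh e v :\ x = nbh e v.
  apply/setP=> k; rewrite !inE; case: (eqVneq k x) => [->|] //=.
  by apply/esym/negP=> h; move: vy; rewrite (iso x y v) ?eqxx // es.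
by exists v.
Qed.

(** * Reductions preserving the signed count of Eulerian sub-digraphs *)

Lemma outdegE (T : finType) (F : {set T * T}) (v : T) :
  outdeg F v = \sum_w ((v, w) \in F).
Proof.
transitivity (\sum_u \sum_w (((u, w) \in F) && (u == v))).
  rewrite pair_bigA /outdeg -sum1_card big_mkcond; apply: eq_bigr => -[u w] _.
  by rewrite !inE; case: (_ && _).
rewrite (bigD1 v) //= [X in _ + X]big1 ?addn0 => [|u /negPf uv].
  by apply: eq_bigr => w _; rewrite eqxx andbT.
by rewrite big1 // => w _; rewrite uv andbF.
Qed.

Lemma indegE (T : finType) (F : {set T * T}) (v : T) :
  indeg F v = \sum_u ((u, v) \in F).
Proof.
transitivity (\sum_u \sum_w (((u, w) \in F) && (w == v))).
  rewrite pair_bigA /indeg -sum1_card big_mkcond; apply: eq_bigr => -[u w] _.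
  by rewrite !inE; case: (_ && _).
apply: eq_bigr => u _; rewrite (bigD1 v) //= big1 ?addn0 ?eqxx ?andbT //.
by move=> w /negPf wv; rewrite wv andbF.
Qed.

Lemma outdegU1 (T : finType) (F : {set T * T}) (p : T * T) (v : T) :
  p \notin F -> outdeg (p |: F) v = (p.1 == v) + outdeg F v.
Proof.
move=> pF; rewrite /outdeg !setIdE setIUl.
have pn : p \notin F :&: [set q | q.1 == v] by rewrite !inE (negPf pF).
case: eqP => pv.
  have -> : [set p] :&: [set q | q.1 == v] = [set p].
    by apply/setIidPl; rewrite sub1set inE pv.
  by rewrite cardsU1 pn.
have -> : [set p] :&: [set q | q.1 == v] = set0; last by rewrite set0U.
by apply/setP=> q; rewrite !inE; apply/negP=> /andP[/eqP-> /eqP].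
Qed.

Lemma indegU1 (T : finType) (F : {set T * T}) (p : T * T) (v : T) :
  p \notin F -> indeg (p |: F) v = (p.2 == v) + indeg F v.
Proof.
move=> pF; rewrite /indeg !setIdE setIUl.
have pn : p \notin F :&: [set q | q.2 == v] by rewrite !inE (negPf pF).
case: eqP => pv.
  have -> : [set p] :&: [set q | q.2 == v] = [set p].
    by apply/setIidPl; rewrite sub1set inE pv.
  by rewrite cardsU1 pn.
have -> : [set p] :&: [set q | q.2 == v] = set0; last by rewrite set0U.
by apply/setP=> q; rewrite !inE; apply/negP=> /andP[/eqP-> /eqP].
Qed.

Lemma outdeg_arcs (T : finType) (o : rel T) (v : T) :
  outdeg (arcs o) v = #|nbh o v|.
Proof.
rewrite outdegE -sum1_card [RHS]big_mkcond; apply: eq_bigr => w _.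
by rewrite !inE; case: (o v w).
Qed.

Lemma eulerian_no_out (T : finType) (o : rel T) (F : {set T * T}) (v : T) :
  eulerian_sub o F -> (forall u, (u, v) \notin F) -> forall w, (v, w) \notin F.
Proof.
move=> /andP[_ /forallP/(_ v)/eqP]; rewrite outdegE indegE => bal noin w.
apply/negP=> h; move: bal; rewrite (bigD1 w) //= h [RHS]big1 // => u _.
by rewrite (negPf (noin u)).
Qed.

Lemma eulerian_sub_mono (T : finType) (o o' : rel T) (F : {set T * T}) :
  subrel o' o -> eulerian_sub o' F -> eulerian_sub o F.
Proof.
move=> sub /andP[/subsetP s h]; apply/andP; split=> //.
by apply/subsetP=> p /s; rewrite !inE; exact: sub.
Qed.

(** With [v] as a source, no Eulerian sub-digraph enters [v], hence none leaves it, and the signed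
    count is that of the smaller graph. *)
Lemma f_AT_source (T : finType) (e : rel T) (v : T) (f : T -> nat) :
  simple_graph e -> #|nbh e v| < f v -> f_AT (del e v) f -> f_AT e f.
Proof.
move=> [es ei] fv [o' [[os ox] at' od]].
pose o u w := o' u w || (u == v) && e v w.
have o'v u w : o' u w -> (u != v) && (w != v) by move/os/andP=> [].
have ou u w : u != v -> o u w = o' u w.
  by move=> /negPf uv; rewrite /o uv orbF.
have ov w : o v w = e v w.
  by rewrite /o eqxx /=; case h: (o' v w) => //; move/o'v: h; rewrite eqxx.
exists o; split.
- split=> [u w|u w euw].
    by case/orP=> [/os/and3P[]|/andP[/eqP->]].
  case: (eqVneq u v) => [?|uv]; last case: (eqVneq w v) => [?|wv].
  + subst; rewrite ov euw ou; last by apply: contraTneq euw => ->; rewrite ei.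
    by case h: (o' w v) => //; move/o'v: h; rewrite eqxx andbF.
  + subst; rewrite ov es euw ou //.
    by case h: (o' u v) => //; move/o'v: h; rewrite eqxx andbF.
  + by rewrite !ou // ox // /del euw uv wv.
- rewrite /AT_orientation; suff -> : diffD o = diffD o' by [].
  apply: eq_bigl => F; apply/idP/idP => h; last first.
    by apply: eulerian_sub_mono h => u w; rewrite /o => ->.
  have /andP[/subsetP s b] := h; apply/andP; split=> //.
  apply/subsetP=> -[u w] uwF; have := s _ uwF; rewrite !inE /=.
  case: (eqVneq u v) => [?|uv]; last by rewrite ou.
  subst; have nin : forall k, (k, v) \notin F; last by rewrite (negPf (eulerian_no_out h nin w)) in uwF.
  move=> k.
  apply/negP=> /s; rewrite inE /= /o; case/orP=> [/o'v|/andP[_]].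
    by rewrite eqxx andbF.
  by rewrite ei.
- move=> u; case: (eqVneq u v) => [->|uv].
    rewrite outdeg_arcs addn1; suff -> : nbh o v = nbh e v by [].
    by apply/setP=> w; rewrite !inE ov.
  apply: leq_trans (od u); rewrite !outdeg_arcs.
  suff -> : nbh o u = nbh o' u by [].
  by apply/setP=> w; rewrite !inE ou.
Qed.

Lemma f_AT_empty (T : finType) (e : rel T) (f : T -> nat) :
  (forall u w, e u w = false) -> (forall v, 0 < f v) -> f_AT e f.
Proof.
move=> e0 f0; exists (fun _ _ => false); split.
- by split=> u w //; rewrite e0.
- have a0 : arcs (fun _ _ : T => false) = set0 by apply/setP=> p; rewrite !inE.
  rewrite /AT_orientation /diffD (big_pred1 set0) ?cards0 // => F.
  rewrite /= /eulerian_sub a0 subset0; case: eqP => // -> /=.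
  by apply/forallP=> v; rewrite outdegE indegE !big1 // => w; rewrite inE.
- move=> v; rewrite outdeg_arcs; suff -> : nbh (fun _ _ : T => false) v = set0.
    by rewrite cards0 f0.
  by apply/setP=> w; rewrite !inE.
Qed.

Lemma int_eq_opp0 (n : int) : n = (- n)%R -> n = 0%R.
Proof. lia. Qed.

(** The involution pairs even sets with odd ones, so the sum equals its own negative. *)
Lemma sum_sign_involution (I : finType) (P : pred {set I}) (h : {set I} -> {set I}) :
  involutive h -> (forall F, P F -> P (h F) && (odd #|h F| != odd #|F|)) ->
  (\sum_(F : {set I} | P F) (-1) ^+ #|F| = 0 :> int)%R.
Proof.
move=> hK hP; apply: int_eq_opp0.
rewrite [LHS](reindex_inj (inv_inj hK)) -GRing.sumrN; apply: eq_big => F.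
  by apply/idP/idP => [/hP/andP[]|/hP/andP[]//]; rewrite hK.
move=> /hP/andP[]; rewrite hK => _; rewrite -[in RHS]GRing.signr_odd -GRing.signr_odd.
by case: (odd _); case: (odd _) => //= _; rewrite ?GRing.expr1 ?GRing.expr0 ?GRing.opprK.
Qed.

(** An Eulerian sub-digraph without the arc from [z] to [a] cannot leave [a], hence cannot leave
    [x], and lives in [o']; those with this arc cancel in pairs. The term [v == z] pays for the new
    arc out of [z]. *)
Lemma f_AT_triangle (T : finType) (e : rel T) (x a b z : T) (f f' : T -> nat) :
  simple_graph e -> a != b -> x != z -> b != z ->
  nbh e x = [set a; b] -> nbh e a = [set x; b; z] ->
  1 < f x -> 2 < f a ->
  (forall v, v != x -> v != a -> f' v + (v == z) <= f v) ->
  f_AT (del (del e x) a) f' -> f_AT e f.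
Proof.
move=> [es ei] ab xz bz Nx Na fx fa ff [o' [[os ox] at' od]].
have exE w : e x w = (w \in [set a; b]) by rewrite -Nx inE.
have eaE w : e a w = (w \in [set x; b; z]) by rewrite -Na inE.
have xa : x != a.
  by apply/eqP=> h; have := ei x; rewrite exE h !inE eqxx.
have xb : x != b.
  by apply/eqP=> h; have := ei x; rewrite exE h !inE eqxx orbT.
have az : a != z.
  by apply/eqP=> h; have := ei a; rewrite eaE h !inE eqxx orbT.
pose D u w := [|| (u == a) && (w == x), (u == a) && (w == b), (u == x) && (w == b)
                | (u == z) && (w == a)].
pose o u w := o' u w || D u w.
have o'xa u w : o' u w -> [&& u != x, w != x, u != a & w != a].
  by move/os/and3P=> [/and3P[_ -> ->] -> ->].
have De u w : D u w -> e u w.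
  by case/or4P=> /andP[/eqP-> /eqP->]; rewrite ?(es z) ?exE ?eaE !inE eqxx ?orbT.
have oa w : o a w = (w == x) || (w == b).
  rewrite /o /D eqxx (eq_sym a x) (negPf xa) (negPf az) /= orbF.
  by case h : (o' a w) => //; move: (o'xa _ _ h); rewrite eqxx !andbF.
have oxE w : o x w = (w == b).
  rewrite /o /D eqxx (negPf xa) (negPf xz) /= orbF.
  by case h : (o' x w) => //; move: (o'xa _ _ h); rewrite eqxx.
have o_a u : o u a = (u == z).
  rewrite /o /D eqxx (eq_sym a x) (negPf xa) (negPf ab) !andbF /= andbT.
  by case h : (o' u a) => //; move: (o'xa _ _ h); rewrite eqxx !andbF.
have o_x u : o u x = (u == a).
  rewrite /o /D eqxx (negPf xa) (negPf xb) !andbF andbT /= orbF.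
  by case h : (o' u x) => //; move: (o'xa _ _ h); rewrite eqxx !andbF.
have oo u w : u != x -> u != a -> w != a -> o u w = o' u w.
  by move=> ux ua wa; rewrite /o /D (negPf ux) (negPf ua) (negPf wa) andbF !orbF.
exists o; split.
- split=> [u w|u w euw].
    by case/orP=> [/os/and3P[/and3P[]]|/De].
  case: (eqVneq u a) => [?|ua]; subst.
    move: euw; rewrite oa o_a eaE !inE.
    case: (eqVneq w z) => [->|wz]; last by rewrite orbF => ->.
    by rewrite (eq_sym z) (negPf xz) (eq_sym z) (negPf bz).
  case: (eqVneq w a) => [?|wa]; subst.
    move: euw; rewrite oa o_a es eaE !inE.
    case: (eqVneq u z) => [->|uz]; last by rewrite orbF => ->.
    by rewrite (eq_sym z) (negPf xz) (eq_sym z) (negPf bz).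
  case: (eqVneq u x) => [?|ux]; subst.
    by move: euw; rewrite oxE o_x exE !inE (negPf wa) => /= ->.
  case: (eqVneq w x) => [?|wx]; subst.
    by move: euw; rewrite oxE o_x es exE !inE (negPf ua) => /= ->.
  by rewrite !oo // ox // /del euw ux ua wx wa.
- rewrite /AT_orientation; suff -> : diffD o = diffD o' by [].
  rewrite /diffD (bigID (fun F : {set T * T} => (z, a) \notin F)) /=.
  rewrite [X in (_ + X)%R = _](_ : _ = 0%R) ?GRing.addr0.
    apply: eq_bigl => F; apply/andP/idP => [[h zaF]|h]; last first.
      split; first by apply: eulerian_sub_mono h => u w; rewrite /o => ->.
      apply/negP=> h1; move: h => /andP[/subsetP/(_ _ h1)].
      by rewrite inE /= => /o'xa; rewrite eqxx !andbF.
    have /andP[/subsetP s bal] := h; apply/andP; split=> //.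
    have noa w : (a, w) \notin F.
      apply: (eulerian_no_out h) => u; apply/negP=> uF; have := s _ uF.
      by rewrite inE /= o_a => /eqP ?; subst; rewrite uF in zaF.
    have nox w : (x, w) \notin F.
      apply: (eulerian_no_out h) => u; apply/negP=> uF; have := s _ uF.
      by rewrite inE /= o_x => /eqP ?; subst; rewrite (negPf (noa x)) in uF.
    apply/subsetP=> -[u w] uwF; have := s _ uwF; rewrite !inE /= => ouw.
    rewrite -(oo u w) //.
    + by apply: contraTneq uwF => ->.
    + by apply: contraTneq uwF => ->.
    + apply: contraTneq uwF => h1; move: ouw; rewrite h1 o_a => /eqP->.
      exact: zaF.
  (* Toggling these three arcs exchanges the routes z->a->b and z->a->x->b, so it
     changes the parity of an Eulerian sub-digraph through (z, a). *)
  pose C : {set T * T} := [set (a, b); (a, x); (x, b)].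
  pose tog (F : {set T * T}) := [set p | (p \in F) (+) (p \in C)].
  have togK : involutive tog.
    by move=> F; apply/setP=> p; rewrite !inE -addbA addbb addbF.
  apply: (sum_sign_involution togK) => F.
  rewrite negbK => /andP[eulF zaF].
  pose K := F :\: C.
  have nabK : (a, b) \notin K by rewrite !inE eqxx.
  have naxK : (a, x) \notin K by rewrite !inE eqxx orbT.
  have nxbK : (x, b) \notin K by rewrite !inE eqxx !orbT.
  have nax2 : (a, x) \notin (x, b) |: K.
    by rewrite in_setU1 negb_or naxK xpair_eqE (eq_sym a x) (negPf xa).
  have za_nC : (z, a) \notin C.
    by rewrite !inE !xpair_eqE (eq_sym z) (negPf az) (eq_sym z) (negPf xz).
  have subK : K \subset arcs o.
    by apply: subset_trans (subsetDl _ _) _; case/andP: eulF.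
  (* The set [K] is completed by either route from [a] to [b]. Both routes shift the balance in the
     same way at every vertex, but they differ in parity. *)
  pose F1 := (a, b) |: K; pose F2 := (a, x) |: ((x, b) |: K).
  have eul12 : eulerian_sub o F1 = eulerian_sub o F2.
    rewrite /eulerian_sub !subUset !sub1set subK !inE /= !oa oxE !eqxx orbT /=.
    apply: eq_forallb => v; rewrite /F1 /F2 !outdegU1 // !indegU1 //=.
    by rewrite (addnCA (a == v)) eqn_add2l.
  have za12 : ((z, a) \in F1) = ((z, a) \in F2).
    move: za_nC; rewrite !in_setU1 /C !inE !negb_or => /andP[/andP[]].
    by move=> /negPf-> /negPf-> /negPf->.
  have odd12 : odd #|F1| != odd #|F2|.
    by rewrite !cardsU1 nabK nax2 nxbK /=; case: (odd _).
  suff [[EF Et]|[EF Et]] : (F = F1 /\ tog F = F2) \/ (F = F2 /\ tog F = F1).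
  + by rewrite Et negbK -eul12 -za12 -EF eulF zaF /= [in X in _ != X]EF eq_sym.
  + by rewrite Et negbK eul12 za12 -EF eulF zaF /= [in X in _ != X]EF.
  have /andP[/subsetP s /forallP bal] := eulF.
  have nF u w : ~~ o u w -> ((u, w) \in F) = false.
    by move=> h; apply/negP=> /s; rewrite inE (negPf h).
  (* The only arc into [a] comes from [z] and lies in [F], so [F] leaves [a] by exactly one arc. *)
  have bala : ((a, x) \in F) + ((a, b) \in F) = 1.
    have := bal a; rewrite outdegE indegE (bigD1 x) //= (bigD1 b) /=; last by rewrite eq_sym.
    rewrite big1 => [|w /andP[wx wb]]; last by rewrite nF // oa negb_or wx.
    rewrite (bigD1 z) //= big1 => [|u uz]; last by rewrite nF // o_a.
    by rewrite zaF !addn0 => /eqP.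
  have balx : ((a, x) \in F) = ((x, b) \in F).
    have := bal x; rewrite outdegE indegE (bigD1 b) //=.
    rewrite big1 => [|w wb]; last by rewrite nF // oxE.
    rewrite (bigD1 a) //= big1 => [|u uz]; last by rewrite nF // o_x.
    by rewrite !addn0 => /eqP; case: (_ \in F); case: (_ \in F).
  case hab : ((a, b) \in F) bala balx => /=.
    case hax : ((a, x) \in F) => // _ hxb; left.
    split; apply/setP=> p; rewrite !inE;
     (case: (eqVneq p (a, b)) => [->|_]; [|case: (eqVneq p (a, x)) => [->|_];
       [|case: (eqVneq p (x, b)) => [->|_]]]);
     rewrite ?hab ?hax -?hxb ?xpair_eqE ?eqxx ?(negPf ab) ?(negPf xb) ?(eq_sym b x)
       ?(negPf xb) ?(negPf xa) ?(eq_sym a x) ?(negPf xa) ?andbF ?addbF ?orbF //=.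
  case hax : ((a, x) \in F) => // _ hxb; right.
  split; apply/setP=> p; rewrite !inE;
   (case: (eqVneq p (a, b)) => [->|_]; [|case: (eqVneq p (a, x)) => [->|_];
     [|case: (eqVneq p (x, b)) => [->|_]]]);
   rewrite ?hab ?hax -?hxb ?xpair_eqE ?eqxx ?(negPf ab) ?(negPf xb) ?(eq_sym b x)
     ?(negPf xb) ?(negPf xa) ?(eq_sym a x) ?(negPf xa) ?andbF ?addbF ?orbF //=.
- move=> v; rewrite outdeg_arcs; case: (eqVneq v x) => [->|vx].
    suff -> : nbh o x = [set b] by rewrite cards1.
    by apply/setP=> w; rewrite !inE oxE.
  case: (eqVneq v a) => [->|va].
    suff -> : nbh o a = [set x; b] by rewrite cards2 xb.
    by apply/setP=> w; rewrite !inE oa.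
  apply: leq_trans (ff v vx va); have := od v; rewrite outdeg_arcs.
  have sub : nbh o v \subset (if v == z then [set a] else set0) :|: nbh o' v.
    apply/subsetP=> w; rewrite !inE; case: (eqVneq w a) => [->|wa].
      by rewrite o_a => /eqP->; rewrite eqxx !inE eqxx.
    by rewrite oo // => ->; rewrite orbT.
  have [le _] := leq_card_setU (if v == z then [set a] else set0) (nbh o' v).
  move: le (subset_leq_card sub); case: (v == z); rewrite ?cards1 ?cards0; clear; lia.
Qed.

(** * Degeneracy, colourings and chains of diamonds *)

(** For symmetric [e], [arcs e] holds each edge in both directions; its size is the measure of the
    inductions on graphs below. *)
Lemma card_arcs_del (T : finType) (e : rel T) (v : T) :
  0 < #|nbh e v| -> #|arcs (del e v)| < #|arcs e|.
Proof.
rewrite card_gt0 => /set0Pn[w]; rewrite inE => evw; apply: proper_card.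
apply/properP; split; last by exists (v, w); rewrite !inE //= /del eqxx andbF.
by apply/subsetP=> p; rewrite !inE => /and3P[].
Qed.

Lemma card_nbh_del_gt0 (T : finType) (e : rel T) (v u : T) :
  0 < #|nbh (del e v) u| -> (u != v) && (0 < #|nbh e u|).
Proof.
rewrite nbh_del; case: eqP => [_|_]; first by rewrite cards0.
by move/leq_trans; apply; apply: subset_leq_card; exact: subsetDl.
Qed.

Lemma nbh_suppress0 (T : finType) (e : rel T) (v a b : T) :
  a != v -> b != v -> nbh (suppress e v a b) v = set0.
Proof.
move=> av bv; apply/setP=> w; rewrite !inE /suppress /del eqxx andbF.
by rewrite !(eq_sym v) (negPf av) (negPf bv).
Qed.

(** Each of [a] and [b] loses the neighbour [v] and gains the other one, to which it was not
    adjacent. *)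
Lemma card_nbh_suppress (T : finType) (e : rel T) (v a b u : T) :
  simple_graph e -> a != b -> ~~ e a b -> nbh e v = [set a; b] -> u != v ->
  #|nbh (suppress e v a b) u| = #|nbh e u|.
Proof.
move=> [es ei] ab eab Nv uv.
have evE w : e v w = (w == a) || (w == b).
  by have := in_set2 w a b; rewrite -Nv inE.
have av : a != v by apply/eqP=> h; have := ei v; rewrite evE h eqxx.
have bv : b != v by apply/eqP=> h; have := ei v; rewrite evE h eqxx orbT.
have swap c d : c != v -> e v c -> ~~ e c d -> d != v ->
    #|d |: nbh e c :\ v| = #|nbh e c|.
  move=> cv evc ecd dv; rewrite cardsU1 !inE dv (negPf ecd) /=.
  by rewrite [RHS](cardsD1 v) inE es evc.
have sE w : suppress e v a b u w =
    [|| (w != v) && e u w, (u == a) && (w == b) | (u == b) && (w == a)].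
  by rewrite /suppress /del uv andbC.
case: (eqVneq u a) => [?|ua]; subst.
  rewrite -(swap a b) ?evE ?eqxx //; congr #|pred_of_set _|.
  by apply/setP=> w; rewrite !inE sE eqxx (negPf ab) orbF orbC.
case: (eqVneq u b) => [?|ub]; subst.
  rewrite -(swap b a) ?evE ?eqxx ?orbT // 1?es //; congr #|pred_of_set _|.
  by apply/setP=> w; rewrite !inE sE eqxx (negPf ua) /= orbC.
congr #|pred_of_set _|; apply/setP=> w; rewrite !inE sE (negPf ua) (negPf ub) !orbF.
by case: (eqVneq w v) => [->|] //=; rewrite es evE (negPf ua) (negPf ub).
Qed.

(** Low vertices other than [y] are made sources and deleted until no edge is left, so [f y = 1] is
    enough. Isolated vertices are exempt from the bound 3, which admits vertices deleted earlier. *)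
Lemma f_AT_degenerate (T : finType) (e : rel T) (y : T) (f : T -> nat) :
  simple_graph e -> K4_minor_free e -> (forall v, 0 < f v) ->
  (forall v, v != y -> 0 < #|nbh e v| -> 2 < f v) -> f_AT e f.
Proof.
have [n] := ubnP #|arcs e|; elim: n e => // n IH e le se free f0 f3.
case: (pickP (mem (arcs e))) => [[u w]|none]; last first.
  by apply: f_AT_empty => // u w; have := none (u, w); rewrite !inE.
rewrite !inE /= => euw; have [v [vy /andP[v0 v2]]] := exists_low_vertex y se free euw.
apply: (f_AT_source (v := v)) => //; first exact: leq_ltn_trans v2 (f3 v vy v0).
apply: IH => //; [| exact: simple_del | exact: K4_minor_free_del |].
- exact: leq_trans (card_arcs_del v0) le.
- by move=> w' wy /card_nbh_del_gt0/andP[_]; exact: f3.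
Qed.

(** Low vertices outside the pair are deleted until no edge has an end there. Then [x] has only the
    neighbour [y] and can be a source of out-degree 1. *)
Lemma f_AT_edge (T : finType) (e : rel T) (x y : T) (f : T -> nat) :
  simple_graph e -> K4_minor_free e -> e x y -> (forall v, 0 < f v) -> 1 < f x ->
  (forall v, v \notin [set x; y] -> 2 < f v) -> f_AT e f.
Proof.
have [n] := ubnP #|arcs e|; elim: n e => // n IH e le se free exy f0 fx f3.
case: (pickP [pred p : T * T | e p.1 p.2 && (p.2 \notin [set x; y])]) => [[u w]|none].
  move=> /andP[/= euw wxy].
  have [v [vxy /andP[v0 v2]]] := exists_low_vertex_edge se free exy euw wxy.
  apply: (f_AT_source (v := v)) => //; first exact: leq_ltn_trans v2 (f3 v vxy).
  apply: IH => //; [| exact: simple_del | exact: K4_minor_free_del |].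
  - exact: leq_trans (card_arcs_del v0) le.
  - by move: vxy; rewrite /del exy !inE negb_or => /andP[vx vy]; rewrite !(eq_sym _ v) vx.
apply: (f_AT_source (v := x)) => //.
  apply: leq_ltn_trans fx; rewrite -(cards1 y); apply: subset_leq_card.
  apply/subsetP=> w; rewrite !inE => exw; have := none (x, w); rewrite /= exw !inE /=.
  move/negbFE/orP=> [/eqP h|//]; have [_ ei] := se; by rewrite h ei in exw.
apply: (@f_AT_degenerate T _ y) => //; [exact: simple_del | exact: K4_minor_free_del |].
by move=> v vy /card_nbh_del_gt0/andP[vx _]; apply: f3; rewrite !inE negb_or vx.
Qed.

Definition proper_coloring (T C : finType) (e : rel T) (c : T -> C) : Prop :=
  forall u w, e u w -> c u != c w.

Lemma proper_coloring_extend (T C : finType) (e : rel T) (v : T) (c : T -> C) :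
  simple_graph e -> #|nbh e v| < #|C| -> proper_coloring (del e v) c ->
  exists2 c', proper_coloring e c' & forall u, u != v -> c' u = c u.
Proof.
move=> [es ei] deg pc.
have [k kc] : exists k, k \notin c @: nbh e v.
  apply/existsP; rewrite -negb_forall; apply/negP=> /forallP h.
  move: deg; rewrite ltnNge => /negP[].
  apply: leq_trans (leq_imset_card c _); rewrite -cardsT; apply: subset_leq_card.
  by apply/subsetP=> k _; exact: h.
have kn w : e v w -> c w != k.
  by move=> h; apply: contraNneq kc => <-; apply: imset_f; rewrite inE.
exists (fun u => if u == v then k else c u) => [u w euw|u /negPf-> //].
case: (eqVneq u v) => [?|uv]; case: (eqVneq w v) => [?|wv]; subst.
- by rewrite ei in euw.
- by rewrite eq_sym kn.
- by rewrite kn // es.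
- by apply: pc; rewrite /del euw uv.
Qed.

(** Greedy colouring: a low vertex sees at most two of the three colours. *)
Lemma K4_minor_free_coloring (T : finType) (e : rel T) :
  simple_graph e -> K4_minor_free e -> exists c : T -> 'I_3, proper_coloring e c.
Proof.
have [n] := ubnP #|arcs e|; elim: n e => // n IH e le se free.
case: (pickP (mem (arcs e))) => [[u w]|none]; last first.
  by exists (fun _ => ord0) => u w euw; have := none (u, w); rewrite !inE /= euw.
rewrite !inE /= => euw; have [v [_ /andP[v0 v2]]] := exists_low_vertex u se free euw.
have [|c pc] := IH (del e v) _ (simple_del v se) (K4_minor_free_del free).
  exact: leq_trans (card_arcs_del v0) le.
have [|c' pc' _] := proper_coloring_extend se _ pc; first by rewrite card_ord.
by exists c'.
Qed.

(** This relates consecutive vertices [u i.-1] and [u i] of a chain, so chains become paths for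
    [connect] and their existence is decidable. *)
Definition diamond (T : finType) (e : rel T) : rel T :=
  fun u u' => [exists v, exists w, [&& e u v, e u w, e v w, e v u' & e w u']].

Lemma diamondP (T : finType) (e : rel T) (u u' : T) :
  reflect (exists v w, [/\ e u v, e u w, e v w, e v u' & e w u']) (diamond e u u').
Proof.
apply: (iffP existsP) => [[v /existsP[w /and5P[]]]|[v [w [h1 h2 h3 h4 h5]]]].
  by exists v, w.
by exists v; apply/existsP; exists w; apply/and5P.
Qed.

Lemma connect_diamond_sub (T : finType) (e e' : rel T) (u w : T) :
  subrel e' e -> connect (diamond e') u w -> connect (diamond e) u w.
Proof.
move=> sub; apply: connect_sub => {u w} u w /diamondP[a [b [h1 h2 h3 h4 h5]]].
by apply: connect1; apply/diamondP; exists a, b; split; exact: sub.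
Qed.

(** The two middle vertices of a diamond use two colours, so both tips have the third. *)
Lemma connect_diamond_color (T : finType) (e : rel T) (c : T -> 'I_3) (u w : T) :
  proper_coloring e c -> connect (diamond e) u w -> c u = c w.
Proof.
move=> pc /connectP[p hp ->] {w}; elim: p u hp => //= v p IH u.
case/andP=> /diamondP[a [b [h1 h2 h3 h4 h5]]] /IH <-; apply: val_inj => /=.
have := (pc _ _ h1, pc _ _ h2, pc _ _ h3, pc _ _ h4, pc _ _ h5).
case: (c u) (c a) (c b) (c v) => [i hi] [j hj] [k hk] [l hl]; rewrite -!val_eqE /=.
by case=> -[[[]]]; lia.
Qed.

Lemma connect_diamond_chain (T : finType) (e : rel T) (x y : T) :
  connect (diamond e) x y -> connected_by_chain_of_diamonds e [set x; y].
Proof.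
move=> /connectP[p hp ->] {y}.
suff [n [u [v [w [h u0 un]]]]] : exists n u v w,
    [/\ diamond_chain_hom e n u v w, u 0 = x & u n = last x p].
  exists n, u, v, w; split=> // z; rewrite !inE => /orP[]/eqP->.
    by exists 0.
  by exists n.
elim: p x hp => [|y p IH] x /=.
  move=> _; exists 0, (fun=> x), (fun=> x), (fun=> x); split=> // i.
  by case/andP=> /leq_trans h /h.
case/andP=> /diamondP[a [b dxy]] /IH[n [u [v [w [h u0 un]]]]].
(* The new diamond goes in front and shifts the indices by one. At index 1 the middle vertices are
   [a] and [b]; their values at 0 are never read. *)
exists n.+1, (fun i => if i is j.+1 then u j else x),
  (fun i => if i is j.+2 then v j.+1 else a), (fun i => if i is j.+2 then w j.+1 else b).
split=> // -[//|[|i]] hi /=; first by rewrite u0.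
exact: (h i.+1).
Qed.

(** * The induction on the number of edges *)

(** Making the diamond condition conditional on [k < 2] lets one induction serve both claims of the
    theorem. *)
Lemma f_AT_ext_fun (T : finType) (e : rel T) (x y : T) (k : nat) :
  simple_graph e -> K4_minor_free e -> x != y -> 0 < k ->
  (k < 2 -> ~~ connect (diamond e) x y) -> f_AT e (ext_fun x y 2 k).
Proof.
have [n] := ubnP #|arcs e|; elim: n e x => // n IH e x le se free xy k0 nch.
have [es ei] := se.
have f0 v : 0 < ext_fun x y 2 k v by rewrite /ext_fun; case: eqP => // _; case: eqP.
have fx : ext_fun x y 2 k x = 2 by rewrite /ext_fun eqxx.
have fy : ext_fun x y 2 k y = k by rewrite /ext_fun eq_sym (negPf xy) eqxx.
have f3 v : v != x -> v != y -> ext_fun x y 2 k v = 3.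
  by rewrite /ext_fun => /negPf-> /negPf->.
have [exy|nexy] := boolP (e x y).
  apply: (f_AT_edge se free exy) => // [|v]; first by rewrite fx.
  by rewrite !inE negb_or => /andP[vx vy]; rewrite f3.
case: (pickP [pred v | [&& v != x, v != y & 0 < #|nbh e v| <= 2]]) => [v|none].
  case/and4P=> vx vy v0 v2; apply: (f_AT_source (v := v)) => //; first by rewrite f3.
  apply: IH => //; [ | exact: simple_del | exact: K4_minor_free_del |].
  - exact: leq_trans (card_arcs_del v0) le.
  - move/nch; apply: contraNN; apply: connect_diamond_sub.
    by move=> u w /and3P[].
have high v : v != x -> v != y -> 0 < #|nbh e v| -> 2 < #|nbh e v|.
  by move=> vx vy v0; have := none v; rewrite /= vx vy v0 /= leqNgt => /negbFE.
have [dx1|dx1] := leqP #|nbh e x| 1.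
  apply: (f_AT_source (v := x)) => //; first by rewrite fx.
  apply: (@f_AT_degenerate T _ y) => //; [exact: simple_del | exact: K4_minor_free_del |].
  by move=> v vy /card_nbh_del_gt0/andP[vx _]; rewrite f3.
(* By [high], a low vertex other than [y] can only be [x]. *)
have /cards2P[a [b [ab Nx]]] : #|nbh e x| == 2.
  have /card_gt0P[w] : 0 < #|nbh e x| by apply: ltnW.
  rewrite inE => exw; have [v [vy /andP[v0 v2]]] := exists_low_vertex y se free exw.
  have vx : v = x by apply: contraTeq v2 => vx; rewrite -ltnNge high.
  by rewrite eqn_leq dx1 -{1}vx v2.
have near c d : nbh e x = [set c; d] -> [/\ e x c, e c x, c != x & c != y].
  move=> N; have xc : e x c by have := in_set2 c c d; rewrite -N inE eqxx.
  split=> //; first by rewrite es.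
    by apply: contraTneq xc => ->; rewrite ei.
  by apply: contraNneq nexy => <-.
have [exa eax ax ay] := near _ _ Nx.
have [exb ebx bx b_y] : [/\ e x b, e b x, b != x & b != y].
  by apply: (near b a); rewrite setUC.
(* Otherwise suppressing [x] keeps all other degrees, and a low vertex of the result would
   contradict [high]. *)
have eab : e a b.
  apply/negPn/negP=> neab.
  have edge : suppress e x a b a b by rewrite /suppress !eqxx orbT.
  have [v [vy]] := exists_low_vertex y (simple_suppress x se ab)
    (K4_minor_free_suppress se exa exb ab free) edge.
  have [->|vx] := eqVneq v x; first by rewrite nbh_suppress0 // cards0.
  by rewrite card_nbh_suppress // => /andP[v0]; rewrite leqNgt high.
pose e1 := del e x; have se1 : simple_graph e1 := simple_del x se.
have free1 : K4_minor_free e1 := K4_minor_free_del free.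
have reduce c d z : c != d -> nbh e x = [set c; d] -> nbh e c = [set x; d; z] ->
    d != z -> x != z -> (k < 2 -> ~~ connect (diamond (del e1 c)) z y) ->
    f_AT e (ext_fun x y 2 k).
  move=> cd Nx' Nc dz xz nchz; have [_ _ cx cy] := near _ _ Nx'.
  have se2 : simple_graph (del e1 c) := simple_del c se1.
  have free2 : K4_minor_free (del e1 c) := K4_minor_free_del free1.
  have fc : 2 < ext_fun x y 2 k c by rewrite f3.
  (* If [z] is [y], the trivial chain forces [k] to be at least 2. The arc out of [z] uses one unit
     of it, and the remaining 1 suffices by degeneracy. *)
  have [zy|zy] := eqVneq z y.
    have k2 : 1 < k.
      by rewrite ltnNge; apply/negP=> /nchz; rewrite zy connect0.
    apply: (f_AT_triangle (f' := fun v => if v == y then 1 else 3) se cd xz) => //.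
    - by rewrite fx.
    - move=> v vx _; have [->|vy] := eqVneq v y; first by rewrite fy zy eqxx.
      by rewrite f3 // zy (negPf vy).
    apply: (@f_AT_degenerate T _ y) => // v; first by case: eqP.
    by move=> /negPf->.
  apply: (f_AT_triangle (f' := ext_fun z y 2 k) se cd xz) => //.
  - by rewrite fx.
  - move=> v vx _; rewrite /ext_fun (negPf vx); case: (eqVneq v z) => [->|vz].
      by rewrite (negPf zy).
    by rewrite addn0.
  apply: IH => //; apply: leq_trans _ (le : #|arcs e| <= n).
  apply: leq_ltn_trans (card_arcs_del (ltnW dx1)); apply: subset_leq_card.
  by apply/subsetP=> p; rewrite !inE => /and3P[].
have core c d : c != d -> nbh e x = [set c; d] -> e c d -> #|nbh e c| = 3 ->
    f_AT e (ext_fun x y 2 k).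
  move=> cd Nx' ecd deg3.
  have [exc ecx cx cy] := near _ _ Nx'.
  have [exd edx dx dy] : [/\ e x d, e d x, d != x & d != y].
    by apply: (near d c); rewrite setUC.
  have third p q r : q != r -> e p q -> e p r -> #|nbh e p| = 3 ->
      exists z, [/\ nbh e p = [set q; r; z], q != z & r != z].
    move=> qr epq epr deg.
    have /cards1P[z Nz] : #|nbh e p :\ q :\ r| == 1.
      have := cardsD1 q (nbh e p); rewrite deg (cardsD1 r (nbh e p :\ q)) !inE.
      by rewrite epq epr (eq_sym r) qr !add1n => -[<-].
    have : z \in nbh e p :\ q :\ r by rewrite Nz set11.
    rewrite !inE => /and3P[zr zq _]; exists z; split; rewrite 1?eq_sym //.
    rewrite -setUA -[nbh e p](setD1K (a := q)) ?inE //.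
    by rewrite -[_ :\ _](setD1K (a := r)) ?Nz // !inE eq_sym qr.
  have [z [Nc xz dz]] : exists z, [/\ nbh e c = [set x; d; z], x != z & d != z].
    by apply: third; rewrite // eq_sym.
  have ecE w : e c w = [|| w == x, w == d | w == z].
    have : (w \in nbh e c) = (w \in [set x; d; z]) by rewrite Nc.
    by rewrite !inE orbA.
  have exE w : e x w = (w == c) || (w == d).
    by have := in_set2 w c d; rewrite -Nx' inE.
  have cz : c != z by apply/eqP=> h; have := ei c; rewrite ecE h eqxx !orbT.
  have [k2|k2] := leqP 2 k.
    by apply: (reduce c d z) => // k1; rewrite leqNgt k1 in k2.
  case: (boolP (connect (diamond (del e1 c)) z y)) => [ch1|nch1]; last exact: (reduce c d z).
  have ch1e : connect (diamond e) z y.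
    by apply: connect_diamond_sub ch1 => u w /and3P[/and3P[]].
  (* Otherwise [c] and [d] are the middle of a diamond with tips [x] and [z], which extends the
     chain to [x]. *)
  have nedz : ~~ e d z.
    apply: contraNN (nch k2) => edz; apply: connect_trans ch1e; apply: connect1.
    by apply/diamondP; exists c, d; split; rewrite // ecE eqxx !orbT.
  have N1c : nbh e1 c = [set d; z].
    apply/setP=> w; rewrite /e1 nbh_del (negPf cx) !inE ecE.
    by case: (eqVneq w x) => [->|//]; rewrite (eq_sym x d) (negPf dx) (negPf xz).
  have e1cd : e1 c d by rewrite /e1 /del ecd cx dx.
  have e1cz : e1 c z by rewrite /e1 /del ecE eqxx !orbT cx (eq_sym z).
  pose e2 := suppress e1 c d z.
  have se2 : simple_graph e2 by exact: simple_suppress.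
  have free2 : K4_minor_free e2 by exact: K4_minor_free_suppress.
  have e2dz : e2 d z by rewrite /e2 /suppress !eqxx orbT.
  (* A low vertex of [e2] other than [y] has the same degree in [e1], at most 2, but degree at least
     3 in [e]. So it is a neighbour of [x] other than [c], namely [d]. *)
  have deg_d : #|nbh e d| = 3.
    have [v [vy /andP[]]] := exists_low_vertex y se2 free2 e2dz.
    have [->|vc] := eqVneq v c.
      by rewrite nbh_suppress0 ?cards0 // eq_sym.
    rewrite card_nbh_suppress //; last by apply: contraNN nedz => /and3P[].
    move=> v0; have /andP[vx ve0] := card_nbh_del_gt0 v0.
    have := high v vx vy ve0; rewrite /e1 nbh_del (negPf vx).
    have := cardsD1 x (nbh e v); rewrite inE es exE (negPf vc) /=.
    have [->|vd] := eqVneq v d; last by rewrite add0n => -> /leq_trans h /h.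
    by rewrite /= => ->; clear; lia.
  have [z' [Nd xz' cz']] : exists z, [/\ nbh e d = [set x; c; z], x != z & c != z].
    by apply: third; rewrite // ?(eq_sym x) // es.
  case: (boolP (connect (diamond (del e1 d)) z' y)) => [ch2|nch2]; last first.
    by apply: (reduce d c z') => //; rewrite 1?eq_sym // setUC.
  have edE w : e d w = [|| w == x, w == c | w == z'].
    have : (w \in nbh e d) = (w \in [set x; c; z']) by rewrite Nd.
    by rewrite !inE orbA.
  have dz' : d != z' by apply/eqP=> h; have := ei d; rewrite edE h eqxx !orbT.
  have zz' : z != z' by apply: contraNneq nedz => ->; rewrite edE eqxx !orbT.
  have e2dz' : e2 d z'.
    by rewrite /e2 /suppress /e1 /del edE eqxx !orbT dx !(eq_sym z') xz' cz' (eq_sym d c) cd.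
  have [|col pcol] := @K4_minor_free_coloring T (suppress e2 d z z') (simple_suppress d se2 zz').
    exact: K4_minor_free_suppress.
  have colzz' : col z != col z' by apply: pcol; rewrite /suppress !eqxx orbT.
  (* A chain from [w] to [y] that avoids [x] and [p] may still pass through [q], so the colouring is
     first extended to [q], with no change elsewhere. *)
  have agree p q w : p != x -> q != x -> p != q -> q != y -> q != w ->
      #|nbh (del e1 p) q| < 3 -> proper_coloring (del (del e1 p) q) col ->
      connect (diamond (del e1 p)) w y -> col w = col y.
    move=> px qx pq qy qw deg pc ch.
    have [|c' pc' c'E] := proper_coloring_extend (simple_del p se1) _ pc.
      by rewrite card_ord.
    by rewrite -!c'E 1?eq_sym // (connect_diamond_color pc' ch).
  case/negP: colzz'; apply/eqP; transitivity (col y).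
    apply: (agree c d) => //.
      apply: leq_ltn_trans (_ : #|[set z']| < 3); last by rewrite cards1.
      apply: subset_leq_card; apply/subsetP=> w; rewrite !inE /e1 /del edE.
      by case/and3P=> /and3P[h _ wx] _ wc; move: h; rewrite (negPf wx) (negPf wc).
    by move=> u w h; apply: pcol; rewrite /suppress /e2 /suppress; move: h;
       rewrite /del => /and3P[-> -> ->].
  apply/esym; apply: (agree d c) => //; first by rewrite eq_sym.
    apply: leq_ltn_trans (_ : #|[set z]| < 3); last by rewrite cards1.
    apply: subset_leq_card; apply/subsetP=> w; rewrite !inE /e1 /del ecE.
    by case/and3P=> /and3P[h _ wx] _ wd; move: h; rewrite (negPf wx) (negPf wd).
  move=> u w /and3P[/and3P[h ud wd] uc wc]; apply: pcol.
  by rewrite /suppress /e2 /suppress /del h ud wd uc wc.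
have e1ab : e1 a b by rewrite /e1 /del eab ax bx.
(* Deleting [x] lowers only the degrees of [a] and [b], each by one, so by [high] the vertex found
   is one of them and has degree exactly 3 in [e]. *)
have [v [vy /andP[v0 v2]]] := exists_low_vertex y se1 free1 e1ab.
have /andP[vx ve0] := card_nbh_del_gt0 v0.
have hv := high v vx vy ve0.
have := cardsD1 x (nbh e v); move: v2; rewrite /e1 nbh_del (negPf vx) inE es.
case exv : (e x v) => v2 dv; last first.
  by move: hv; rewrite dv add0n ltnNge v2.
have {}dv : #|nbh e v| = 3 by move: hv v2; rewrite dv; clear; lia.
have : v \in [set a; b] by rewrite -Nx inE.
rewrite !inE => /orP[]/eqP ?; subst v; first exact: (core a b).
apply: (core b a) => //; [by rewrite eq_sym | by rewrite setUC | by rewrite es].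
Qed.

Theorem mainTheorem1 (T : finType) (e : rel T) (x y : T) :
  simple_graph e -> K4_minor_free e -> x != y ->
  AT_extendable2 e 2 2 x y /\
  (~ connected_by_chain_of_diamonds e [set x; y] -> AT_extendable2 e 2 1 x y).
Proof.
move=> se free xy; split=> [|nch]; apply: f_AT_ext_fun => // _.
by apply/negP=> /connect_diamond_chain.
Qed.
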